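(* Fix a price vector $p\in\mathbb R_+^M$, let $X^*$ be the unique minimal maximizer of the over-demand function $\mathcal O(\cdot;p)$, and let $z^*=\chi_{X^*}+\gamma t$ ($t\in\mathbb R^M$) be the unique minimal solution of the problem $(D_2)$ at $p$ defined in the context. Then the direction $d^*\in\mathbb R_+^M$ given by $d^*_j=\exp(t_j)$ for $j\in X^*$ and $d^*_j=0$ for $j\in M\setminus X^*$ (the output of Algorithm 2) satisfies (LSC) at $p$.
   Context: **Market model.** $M=\{1,\dots,m\}$ is the set of goods, $N=\{1,\dots,n\}$ with $n\ge 2$ the set of buyers, $s\in\mathbb Z_+^M$ the supply vector, and $[\mathbf 0,s]_{\mathbb Z}=\{x\in\mathbb Z_+^M : x\le s\}$ (vector inequalities are componentwise). For $x\in\mathbb R^M$ and $X\subseteq M$ put $x(X)=\sum_{j\in X}x_j$; $\chi_X\in\{0,1\}^M$ is the characteristic vector of $X$, $\chi_j=\chi_{\{j\}}$, $\chi_0=\mathbf 0$; $\operatorname{supp}_+(x)=\{j:x_j>0\}$, $\operatorname{supp}_-(x)=\{j:x_j<0\}$. Each buyer $i$ has a valuation $v_i:[\mathbf 0,s]_{\mathbb Z}\to\mathbb R_+$ with $v_i(\mathbf 0)=0$, monotone ($x\le y\Rightarrow v_i(x)\le v_i(y)$), and $\mathrm M^\natural$-concave: for all $x,x'\in[\mathbf 0,s]_{\mathbb Z}$ and $j\in\operatorname{supp}_+(x-x')$ there is $k\in\operatorname{supp}_-(x-x')\cup\{0\}$ with $v_i(x)+v_i(x')\le v_i(x-\chi_j+\chi_k)+v_i(x'+\chi_j-\chi_k)$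 (with $v_i=-\infty$ outside $[\mathbf 0,s]_{\mathbb Z}$). For each $(i,j)\in N\times M$ there is a payment function $q_{ij}:\mathbb R_+\to\mathbb R_+$ that is continuous, piecewise-linear (specified by finitely many breakpoints and slopes), strictly increasing, with $q_{ij}(0)=0$, and such that $q_{ij}(\kappa)=v_i(\chi_j)$ for some $\kappa\in\mathbb R_+$; $q'_{ij}$ denotes its right derivative. For a price vector $p\in\mathbb R_+^M$, $u_i(x;p)=v_i(x)-\sum_{j\in M}q_{ij}(p_j)x_j$, $D_i(p)=\arg\max_{x\in[\mathbf 0,s]_{\mathbb Z}}u_i(x;p)$, and $\check D_i(p)$ is the set of (componentwise) minimal elements of $D_i(p)$. **Over-demand.** $\mu_i(X;p)=\min\{x(X):x\in D_i(p)\}$ and $\mathcal O(X;p)=\sum_{i\in N}\mu_i(X;p)-s(X)$ for $X\subseteq M$. The function $\mathcal O(\cdot;p)$ is supermodular, so it has a unique inclusion-minimal maximizer. **Local Stability Condition (LSC).** A direction $d\in\mathbb R_+^M$ satisfies (LSC) at $p$ if there is $\delta>0$ such that for every $\varepsilon\in[0,\delta)$ the set $\operatorname{supp}_+(d)$ is the unique minimal maximizer of $\mathcal O(\cdot;p+\varepsilon d)$. **Lexicographic dual problem $(D_2)$.** Let $\check\rho_i(X;p)=\max\{x(X):x\in\check D_i(p)\}$ and $P(\check\rho_i)=\{x\in\mathbb Z_+^M: x(S)\le\check\rho_i(S;p)\ \forall S\subseteq M\}$. Let $\gamma$ be a symbolic ''sufficiently small'' positive constant: let $\mathbb R_\gamma=\{a+\gamma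 b: a,b\in\mathbb R\}$ (identified with pairs $(a,b)$), with addition componentwise in $(a,b)$ and with the lexicographic order ($a_1+\gamma b_1>a_2+\gamma b_2$ iff $a_1>a_2$, or $a_1=a_2$ and $b_1>b_2$); vectors over $\mathbb R_\gamma$ are compared componentwise. Put $w_{ij}=1-\gamma\log q'_{ij}(p_j)$. Problem $(D_2)$ is to minimize, over $z\in\mathbb R_\gamma^M$ with $z\ge\mathbf 0$, $\mathcal L(z)=\sum_{i\in N}\max_{x_i\in P(\check\rho_i)}\sum_{j\in M}(w_{ij}-z_j)x_{ij}+\sum_{j\in M}s_jz_j$. It is known that $(D_2)$ has a unique minimal optimal solution and that it has the form $\chi_{X^*}+\gamma t$ with $t\in\mathbb R^M$. *)

(* Defs.v *)
From HB Require Import structures.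
From mathcomp Require Import all_boot all_order all_algebra.
From mathcomp Require Import all_classical all_reals all_analysis.
Set Implicit Arguments.
Unset Strict Implicit.
Unset Printing Implicit Defensive.
Import Order.TTheory GRing.Theory Num.Theory numFieldNormedType.Exports.
Local Open Scope classical_set_scope.
Local Open Scope ring_scope.

Section Generic.

Definition minimals (T : Type) (le : T -> T -> Prop) (A : set T) : set T :=
  [set a | A a /\ forall b, A b -> le b a -> b = a].

Definition unique_minimal (T : Type) (le : T -> T -> Prop) (A : set T) (a : T) :=
  minimals le A a /\ forall b, minimals le A b -> b = a.

Definition argmax (T : Type) (d : Order.disp_t) (V : porderType d)
    (A : set T) (f : T -> V) : set T :=
  [set a | A a /\ forall b, A b -> (f b <= f a)%O].

Definition argmin (T : Type) (d : Order.disp_t) (V : porderType d)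
    (A : set T) (f : T -> V) : set T :=
  [set a | A a /\ forall b, A b -> (f a <= f b)%O].

(* Maximum and minimum of a set. The default value 0 is returned when there is
   none, which does not happen below: the sets are nonempty, finite and
   totally ordered. *)
Definition maxs (V : porderZmodType) (A : set V) : V := xget 0 (A `&` ubound A).

Definition mins (V : porderZmodType) (A : set V) : V := xget 0 (A `&` lbound A).

Definition vle (V : porderZmodType) (m : nat) (x y : {ffun 'I_m -> V}) : Prop :=
  forall j, x j <= y j.

End Generic.

(* The pair (a, b) stands for a + gamma b, gamma an infinitesimal. *)
Definition Rgamma (R : realType) : Type := R * R.

Section RgammaOrder.
Variable R : realType.

HB.instance Definition _ := GRing.Zmodule.copy (Rgamma R) (R * R)%type.

Definition lexle (x y : Rgamma R) : bool :=
  (x.1 < y.1) || ((x.1 == y.1) && (x.2 <= y.2)).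

Lemma lexle_refl : reflexive lexle.
Proof. by move=> x; rewrite /lexle eqxx lexx orbT. Qed.

Lemma lexle_anti : antisymmetric lexle.
Proof.
move=> [a b] [c d]; rewrite /lexle /=.
by case: (ltgtP a c) => //= -> /le_anti ->.
Qed.

Lemma lexle_trans : transitive lexle.
Proof.
move=> [a b] [c d] [e f]; rewrite /lexle /=.
case: (ltgtP c a) => //= [ca _|->].
  case: (ltgtP a e) => //= [ae|<-] _; last by rewrite ca.
  by rewrite (lt_trans ca ae).
case: (ltgtP a e) => //= _; exact: le_trans.
Qed.

Lemma lexle_total : total lexle.
Proof.
move=> [a b] [c d]; rewrite /lexle /=.
by case: (ltgtP a c) => //= _; exact: le_total.
Qed.

HB.instance Definition _ := Order.Le_isPOrder.Build ring_display (Rgamma R)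
  lexle_refl lexle_anti lexle_trans.

HB.instance Definition _ := Order.POrder_isTotal.Build ring_display (Rgamma R)
  lexle_total.

End RgammaOrder.

Section Vectors.
Context {m : nat}.

Definition tot (x : {ffun 'I_m -> int}) (X : {set 'I_m}) : int :=
  \sum_(j in X) x j.

Definition chi (V : pzRingType) (X : {set 'I_m}) : {ffun 'I_m -> V} :=
  [ffun j => (j \in X)%:R].

(* The unit vector chi_k, with None for the index 0 (chi_0 = 0). *)
Definition chi_opt (k : option 'I_m) : {ffun 'I_m -> int} :=
  if k is Some j then chi int [set j]%SET else 0.

Definition supp_pos (V : porderZmodType) (x : {ffun 'I_m -> V}) : {set 'I_m} :=
  [set j | 0 < x j]%SET.

Definition supp_neg (V : porderZmodType) (x : {ffun 'I_m -> V}) : {set 'I_m} :=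
  [set j | x j < 0]%SET.

Definition subset_le (X Y : {set 'I_m}) : Prop := X \subset Y.

End Vectors.

Section Assumptions.
Variables (R : realType) (m : nat) (s : {ffun 'I_m -> nat}).
Implicit Types (v : {ffun 'I_m -> int} -> R) (q : R -> R).

Definition box : set {ffun 'I_m -> int} :=
  [set x : {ffun 'I_m -> int} | forall j, 0 <= x j <= (s j)%:Z].

(* A valuation is only meaningful on the box; its other values are discarded
   by [vext], which is -oo there. *)
Definition vext v (x : {ffun 'I_m -> int}) : \bar R :=
  if x \in box then (v x)%:E else -oo%E.

Definition Mnat_concave v : Prop :=
  forall x x', box x -> box x' -> forall j, j \in supp_pos (x - x') ->
  exists k : option 'I_m,
    (if k is Some l then l \in supp_neg (x - x') else true) /\
    (vext v x + vext v x' <= vext v (x - chi_opt (Some j) + chi_opt k)%R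
                           + vext v (x' + chi_opt (Some j) - chi_opt k)%R)%E.

Definition valuation v : Prop :=
  [/\ forall x, box x -> 0 <= v x,
      v 0 = 0,
      forall x y, box x -> box y -> vle x y -> v x <= v y
    & Mnat_concave v].

(* Breakpoints 0 < b_1 < ... < b_r, and slope c_l on [b_l, b_(l+1)[, where
   b_0 = 0 and b_(r+1) = +oo. *)
Definition piecewise_linear q : Prop :=
  exists (b : seq R) (c : nat -> R),
    path <%R 0 b /\
    forall l, (l <= size b)%N ->
    forall x, nth 0 (0 :: b) l <= x ->
      ((l < size b)%N -> x < nth 0 b l) ->
      q x = q (nth 0 (0 :: b) l) + c l * (x - nth 0 (0 :: b) l).

(* A payment function is only meaningful on [0, +oo[. *)
Definition payment_function q : Prop :=
  [/\ forall k, 0 <= k -> 0 <= q k,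
      {within `[0, +oo[, continuous q},
      piecewise_linear q,
      forall k l, 0 <= k -> k < l -> q k < q l
    & q 0 = 0].

Definition right_derivative q (k : R) : R :=
  lim (h^-1 * (q (k + h) - q k) @[h --> 0^'+]).

End Assumptions.

Section Market.
Variables (R : realType) (m n : nat) (s : {ffun 'I_m -> nat}).
Variables (v : 'I_n -> {ffun 'I_m -> int} -> R) (q : 'I_n -> 'I_m -> R -> R).
Implicit Types (i : 'I_n) (X : {set 'I_m}) (p d : {ffun 'I_m -> R}).

(* The clause on kappa is required of the goods with s_j > 0 only: when
   s_j = 0 the vector chi_j lies outside the domain of v_i. *)
Definition market : Prop :=
  [/\ forall i, valuation s (v i),
      forall i j, payment_function (q i j)
    & forall i j, (0 < s j)%N ->
        exists2 k, 0 <= k & q i j k = v i (chi int [set j]%SET)].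

Definition utility i (x : {ffun 'I_m -> int}) p : R :=
  v i x - \sum_j q i j (p j) * (x j)%:~R.

Definition demand i p : set {ffun 'I_m -> int} :=
  argmax (box s) (fun x => utility i x p).

Definition min_demand i p : set {ffun 'I_m -> int} :=
  minimals (@vle int m) (demand i p).

Definition mu i X p : int := mins [set tot x X | x in demand i p].

Definition overdemand p X : int :=
  \sum_i mu i X p - \sum_(j in X) (s j)%:Z.

Definition minimal_maximizer p X : Prop :=
  unique_minimal subset_le (argmax [set: {set 'I_m}] (overdemand p)) X.

Definition LSC p d : Prop :=
  (forall j, 0 <= d j) /\
  exists2 delta : R, 0 < delta &
    forall eps, 0 <= eps < delta ->
      minimal_maximizer (p + eps *: d) (supp_pos d).

Definition rho_check i X p : int := maxs [set tot x X | x in min_demand i p].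

Definition P_rho_check i p : set {ffun 'I_m -> int} :=
  [set x : {ffun 'I_m -> int} | (forall j, 0 <= x j) /\ forall X, tot x X <= rho_check i X p].

Definition weight p i (j : 'I_m) : Rgamma R :=
  (1, - ln (right_derivative (q i j) (p j))).

Definition D2_objective p (z : {ffun 'I_m -> Rgamma R}) : Rgamma R :=
  \sum_i maxs [set \sum_j (weight p i j - z j) *~ x j | x in P_rho_check i p]
  + \sum_j z j *+ s j.

Definition D2_solutions p : set {ffun 'I_m -> Rgamma R} :=
  argmin [set z | vle 0 z] (D2_objective p).

Definition D2_minimal_solution p (z : {ffun 'I_m -> Rgamma R}) : Prop :=
  unique_minimal (@vle (Rgamma R) m) (D2_solutions p) z.

(* chi_X + gamma t *)
Definition lex_vector X (t : {ffun 'I_m -> R}) : {ffun 'I_m -> Rgamma R} :=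
  [ffun j => (chi R X j, t j)].

Definition direction X (t : {ffun 'I_m -> R}) : {ffun 'I_m -> R} :=
  [ffun j => if j \in X then expR (t j) else 0].

End Market.

(* Main.v *)
(* The minimal bundles of a demand set all have the same size and form an
   M-convex set, on which a bundle chosen greedily along an ordering of the
   goods is tight on every prefix of the ordering. By Abel summation such a
   bundle maximizes every linear function that is antitone along the ordering,
   both over the minimal bundles and, after truncation, over P(rho_check).

   Raising p by e d, with e small, only breaks ties inside the demand sets:
   buyer i minimizes the linear cost with coefficients q'_ij d_j, whose order
   on X is that of the weights of (D_2) at z*. Given Y, put W = X minus Y.
   By minimality of z*, decreasing the W-coordinates of z* infinitesimally
   increases the dual objective, so the greedy bundles that prefer W among ties
   over-demand W. Ordering the goods outside X differently does not change a
   greedy bundle on X. Listing first the goods outside X and Y, then Y minus X,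
   makes the bundle attain mu_i on X and on the union of X and Y, and
   optimality of X at p gives O(Y) <= O(X) at p + e d, strictly unless W is
   empty. *)
Require Import Defs.
From mathcomp Require Import all_boot all_order all_algebra.
From mathcomp Require Import all_classical all_reals all_analysis.
From mathcomp Require Import zify ring lra.
Set Implicit Arguments.
Unset Strict Implicit.
Unset Printing Implicit Defensive.
Import Order.TTheory GRing.Theory Num.Theory numFieldNormedType.Exports.
Local Open Scope ring_scope.

(** * Extrema over finite sets, and finiteness of the box *)

Lemma finite_argmin (T : eqType) (d : Order.disp_t) (V : orderType d)
    (A : set T) (f : T -> V) :
  finite_set A -> (A !=set0)%classic ->
  exists2 a, A a & forall b, A b -> (f a <= f b)%O.
Proof.
move=> /finite_seqP[l ->] [x0 /=].
elim: l x0 => [//|y l IH] x0 _.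
case: l IH => [|z l] IH.
  exists y; first by rewrite /= mem_seq1.
  by move=> b /=; rewrite mem_seq1 => /eqP ->.
have [a al amin] := IH z (mem_head _ _).
case: (leP (f y) (f a)) => fya.
  exists y; first exact: mem_head.
  move=> b /=; rewrite in_cons => /orP[/eqP->//|/amin]; exact: le_trans.
exists a; first by rewrite /= in_cons [X in _ || X]al orbT.
move=> b /=; rewrite in_cons => /orP[/eqP->|/amin//]; exact: ltW.
Qed.

Lemma mins_image (T : Type) (V : porderZmodType) (A : set T) (f : T -> V) a :
  A a -> (forall b, A b -> f a <= f b) -> mins [set f x | x in A]%classic = f a.
Proof.
move=> Aa amin; apply: xget_unique.
  split; first by exists a.
  by move=> _ [b Ab <-]; exact: amin.
move=> y [[b Ab <-] /(_ (f a)) bmin].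
by apply/le_anti; rewrite bmin ?amin//; exists a.
Qed.

Lemma maxs_image (T : Type) (V : porderZmodType) (A : set T) (f : T -> V) a :
  A a -> (forall b, A b -> f b <= f a) -> maxs [set f x | x in A]%classic = f a.
Proof.
move=> Aa amax; apply: xget_unique.
  split; first by exists a.
  by move=> _ [b Ab <-]; exact: amax.
move=> y [[b Ab <-] /(_ (f a)) bmax].
by apply/le_anti; rewrite bmax ?amax//; exists a.
Qed.

Lemma finite_box m (s : {ffun 'I_m -> nat}) : finite_set (box s).
Proof.
pose N := (\max_j s j).+1.
pose F (g : {ffun 'I_m -> 'I_N}) := [ffun j => (g j : nat)%:Z].
apply: (@sub_finite_set _ _ [set F g | g in setT]%classic); last first.
  by apply: finite_image; exact: finite_finset.
have bnd (x : {ffun 'I_m -> int}) j : box s x -> `|x j|%:Z = x j /\ (`|x j| < N)%N.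
  move=> /(_ j)/andP[x0 xs]; split; first by rewrite gez0_abs.
  have sj : (s j <= \max_j s j)%N by exact: leq_bigmax.
  by rewrite ltnS (leq_trans _ sj)//; lia.
move=> x bx /=; exists [ffun j => inord `|x j|%N] => //.
by apply/ffunP => j; have [xj lt] := bnd x j bx; rewrite !ffunE inordK.
Qed.

(** * Exchange properties, totals and distances of integer vectors *)

(* M-natural exchange, None being the index 0 of the informal axiom; the
   version without None characterizes M-convex sets. *)
Definition exchange m (D : set {ffun 'I_m -> int}) : Prop :=
  forall x y, D x -> D y -> forall j, y j < x j ->
  exists k : option 'I_m,
    [/\ if k is Some l then x l < y l else true,
        D (x - chi_opt (Some j) + chi_opt k)
      & D (y + chi_opt (Some j) - chi_opt k)].

Definition exchange_base m (B : set {ffun 'I_m -> int}) : Prop :=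
  forall x y, B x -> B y -> forall j, y j < x j ->
  exists k, [/\ x k < y k,
        B (x - chi_opt (Some j) + chi_opt (Some k))
      & B (y + chi_opt (Some j) - chi_opt (Some k))].

Definition l1dist m (x y : {ffun 'I_m -> int}) : nat := (\sum_j `|x j - y j|)%N.

Lemma chi_optE m (j k : 'I_m) : chi_opt (Some j) k = (k == j)%:R.
Proof. by rewrite /chi_opt /chi ffunE inE. Qed.

Lemma ffun_addE m (V : zmodType) (x y : {ffun 'I_m -> V}) j : (x + y) j = x j + y j.
Proof. by rewrite ffunE. Qed.

Lemma ffun_oppE m (V : zmodType) (x : {ffun 'I_m -> V}) j : (- x) j = - x j.
Proof. by rewrite ffunE. Qed.

Lemma exchangeE m (x : {ffun 'I_m -> int}) (j k l : 'I_m) :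
  (x - chi_opt (Some j) + chi_opt (Some k)) l = x l - (l == j)%:R + (l == k)%:R.
Proof. by rewrite -!chi_optE !ffun_addE ffun_oppE. Qed.

Lemma exchange_NoneE m (x : {ffun 'I_m -> int}) (j l : 'I_m) :
  (x - chi_opt (Some j) + chi_opt None) l = x l - (l == j)%:R.
Proof. by rewrite addr0 -!chi_optE ffun_addE ffun_oppE. Qed.

Lemma tot_chi m (j : 'I_m) (S : {set 'I_m}) : tot (chi_opt (Some j)) S = (j \in S)%:R.
Proof.
rewrite /tot; case: (boolP (j \in S)) => jS.
  rewrite (bigD1 j)//= chi_optE eqxx big1 ?addr0// => k /andP[_ /negbTE kj].
  by rewrite chi_optE kj.
rewrite big1// => k kS; rewrite chi_optE; case: eqP => // kj.
by rewrite kj (negbTE jS) in kS.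
Qed.

Lemma totD m (x y : {ffun 'I_m -> int}) S : tot (x + y) S = tot x S + tot y S.
Proof. by rewrite /tot -big_split; apply: eq_bigr => j _; rewrite ffunE. Qed.

Lemma totN m (x : {ffun 'I_m -> int}) S : tot (- x) S = - tot x S.
Proof. by rewrite /tot -sumrN; apply: eq_bigr => j _; rewrite ffunE. Qed.

Lemma tot_le m (x y : {ffun 'I_m -> int}) S : vle x y -> tot x S <= tot y S.
Proof. by move=> xy; apply: ler_sum. Qed.

Lemma tot_setC m (x : {ffun 'I_m -> int}) (S : {set 'I_m}) :
  tot x [set: 'I_m] = tot x S + tot x (~: S).
Proof.
rewrite /tot (bigID (mem S)) /=; congr (_ + _); apply: eq_bigl => j;
  by rewrite ?inE.
Qed.

Lemma tot_setD m (x : {ffun 'I_m -> int}) (S T : {set 'I_m}) :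
  S \subset T -> tot x T = tot x S + tot x (T :\: S).
Proof.
move=> /fintype.subsetP ST; rewrite /tot (bigID (mem S)) /=; congr (_ + _); apply: eq_bigl => j.
  by rewrite andbC; case: (boolP (j \in S)) => //= /ST ->.
by rewrite inE andbC.
Qed.

(** The unit leaves a good where [x] exceeds [y] and enters one where [x] falls short, so both
    coordinates approach [y]. This gives the descent in the extremal arguments below. *)
Lemma l1dist_exchange m (x y : {ffun 'I_m -> int}) j k :
  y j < x j -> x k < y k ->
  (l1dist (x - chi_opt (Some j) + chi_opt (Some k))%R y < l1dist x y)%N.
Proof.
move=> yxj xyk; have jk : j != k by apply/eqP => jk; move: yxj xyk; rewrite jk; lia.
rewrite /l1dist (bigD1 j)//= [X in (_ < X)%N](bigD1 j)//= -addSn leq_add//.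
  by rewrite exchangeE eqxx (negbTE jk); lia.
apply: leq_sum => l lj; rewrite exchangeE (negbTE lj).
by case: eqP => [->|_]; lia.
Qed.

Lemma vle_tot_eq m (x y : {ffun 'I_m -> int}) :
  vle x y -> tot y [set: 'I_m] <= tot x [set: 'I_m] -> x = y.
Proof.
move=> xy yx; apply/ffunP => j; apply/eqP; rewrite eq_le xy leNgt.
apply/negP => xyj; move: yx; apply/negP; rewrite -ltNge.
rewrite /tot (bigD1 j) ?inE//= [ltRHS](bigD1 j) ?inE//=.
by rewrite ltr_leD// ler_sum.
Qed.

(** * Minimal bundles of a set with the exchange property, and greedy bundles *)

Lemma finite_minimal m (D : set {ffun 'I_m -> int}) x :
  finite_set D -> D x ->
  exists2 y, minimals (@vle int m) D y & vle y x.
Proof.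
move=> fD Dx.
have [y [Dy yx] ymin] := @finite_argmin _ _ _ (D `&` [set y | vle y x])%classic
   (fun y => tot y [set: 'I_m])
   (sub_finite_set (@subIsetl _ _ _) fD)
   (ex_intro _ x (conj Dx (fun j => lexx (x j)))).
exists y => //; split => // z Dz zy; apply: vle_tot_eq => //.
by apply: ymin; split => // k; exact: le_trans (zy k) (yx k).
Qed.

(** Among the elements of smaller total than [x], let [z] be closest to [x], and exchange at a good
    where [z] is below [x]. With [None], a unit could be removed from [x], against minimality;
    otherwise [z] moves closer to [x] at the same total. *)
Lemma minimal_min_tot m (D : set {ffun 'I_m -> int}) x y :
  finite_set D -> exchange D -> minimals (@vle int m) D x -> D y ->
  tot x [set: 'I_m] <= tot y [set: 'I_m].
Proof.
move=> fD exD [Dx xmin] Dy; rewrite leNgt; apply/negP => yx.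
have [z [Dz zx] zmin] := @finite_argmin _ _ _
   (D `&` [set z | tot z [set: 'I_m] < tot x [set: 'I_m]])%classic
   (fun z => l1dist z x) (sub_finite_set (@subIsetl _ _ _) fD)
   (ex_intro _ y (conj Dy yx)).
have [j zxj] : exists j, z j < x j.
  apply: contrapT => /forallNP xz; move: zx => /=; apply/negP; rewrite -leNgt.
  by apply: tot_le => k; rewrite leNgt; exact/negP.
have [[k|] [xzk Dxj Dzj]] := exD _ _ Dx Dz j zxj; last first.
  have : x - chi_opt (Some j) + chi_opt None = x.
    by apply: xmin => // k; rewrite exchange_NoneE gerBl ler0n.
  by move=> /ffunP/(_ j)/eqP; rewrite exchange_NoneE eqxx lt_eqF ?gtrBl.
have : (l1dist (z - chi_opt (Some k) + chi_opt (Some j))%R x < l1dist z x)%N.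
  exact: l1dist_exchange.
rewrite ltnNge => /negP; apply; apply: zmin; split.
  by rewrite addrAC.
by rewrite /= !totD !totN !tot_chi !inE subrK.
Qed.

(** Minimal elements are exactly those of least total, and a swap preserves totals, so swapped
    bundles stay minimal. The case [None] would contradict the minimality of [x]. *)
Lemma minimals_exchange m (D : set {ffun 'I_m -> int}) :
  finite_set D -> exchange D -> exchange_base (minimals (@vle int m) D).
Proof.
move=> fD exD x y Bx By j yxj.
have [Dx xmin] := Bx; have [Dy ymin] := By.
have minD z : D z -> tot z [set: 'I_m] <= tot x [set: 'I_m] -> minimals (@vle int m) D z.
  move=> Dz zx; have [w Bw wz] := finite_minimal fD Dz.
  have <- // : w = z.
  by apply: vle_tot_eq => //; apply: le_trans zx (minimal_min_tot fD exD Bx Bw.1).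
have [[k|] [xyk Dxj Dyj]] := exD _ _ Dx Dy j yxj; last first.
  have : x - chi_opt (Some j) + chi_opt None = x.
    by apply: xmin => // k; rewrite exchange_NoneE gerBl ler0n.
  by move=> /ffunP/(_ j)/eqP; rewrite exchange_NoneE eqxx lt_eqF ?gtrBl.
exists k; split => //; apply: minD => //; rewrite !totD !totN !tot_chi !inE ?subrK ?addrK//.
exact: minimal_min_tot Dx.
Qed.

(* The greedy bundle minimizes a linear function whose coefficients increase
   along l. *)
Lemma greedy m (B : set {ffun 'I_m -> int}) (l : seq 'I_m) :
  finite_set B -> (B !=set0)%classic -> exchange_base B -> (forall j, j \in l) ->
  exists2 y, B y & forall k x, B x ->
    tot x [set j in take k l] <= tot y [set j in take k l].
Proof.
move=> fB B0 exB ml.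
have [y By ymin] := finite_argmin
  (fun x : {ffun 'I_m -> int} => \sum_j (index j l)%:Z * x j) fB B0.
exists y => // n x Bx; set U := [set j in take n l]%SET.
rewrite leNgt; apply/negP => yx.
have [z [Bz yz] zmin] := @finite_argmin _ _ _
   (B `&` [set z | tot y U < tot z U])%classic
   (fun z => l1dist z y) (sub_finite_set (@subIsetl _ _ _) fB)
   (ex_intro _ x (conj Bx yx)).
have [j [jU yzj]] : exists j, j \in U /\ y j < z j.
  apply: contrapT => /forallNP zy; move: yz => /=.
  rewrite ltNge => /negP; apply; apply: ler_sum => j jU.
  by rewrite leNgt; apply/negP => yzj; apply: (zy j).
have [k [zyk Bzj Byj]] := exB _ _ Bz By j yzj.
(* Optimality of [y] forces [k] to be listed no later than [j], so [k] is in the prefix [U] as well.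
   Swapping in [z] then keeps its total on [U] and brings it closer to [y], against the choice of
   [z]. *)
have := ymin _ Byj.
have -> : \sum_i (index i l)%:Z * (y + chi_opt (Some j) - chi_opt (Some k)) i =
   \sum_i (index i l)%:Z * y i + (index j l)%:Z - (index k l)%:Z.
  under eq_bigr do rewrite addrAC exchangeE !mulrDr mulrN addrAC.
  rewrite !big_split /= sumrN; congr (_ + _ - _).
    by rewrite (bigD1 j)//= eqxx mulr1 big1 ?addr0// => i /negbTE ->; rewrite mulr0.
  by rewrite (bigD1 k)//= eqxx mulr1 big1 ?addr0// => i /negbTE ->; rewrite mulr0.
rewrite -addrA lerDl subr_ge0 lez_nat => kj.
have kU : k \in U.
  by move: jU; rewrite !inE !in_take//; exact: leq_ltn_trans.
have := l1dist_exchange yzj zyk.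
rewrite ltnNge => /negP; apply; apply: zmin; split => //=.
by rewrite !totD !totN !tot_chi jU kU subrK.
Qed.

(** * Abel summation over prefixes *)

(** A [porderZmodType] does not relate order and addition, so their compatibility is the hypothesis
    [leD]. This lets the summation lemmas serve both [R] and [Rgamma R]. *)
Lemma ler_mulrz (V : porderZmodType)
    (leD : forall x y z : V, x <= y -> x + z <= y + z) (a b : V) (c : int) :
  0 <= c -> a <= b -> a *~ c <= b *~ c.
Proof.
case: c => // n _ ab; rewrite -!pmulrn.
elim: n => [|n IH]; first by rewrite !mulr0n.
by rewrite !mulrS; apply: le_trans (leD _ _ _ ab) _; rewrite ![b + _]addrC leD.
Qed.

(* Abel summation: d is tested against the indicators of the prefixes of l,
   of which f is a nonnegative combination. The carry c makes the induction
   go through. *)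
Lemma abel_carry (I : Type) (V : porderZmodType)
    (leD : forall x y z : V, x <= y -> x + z <= y + z)
    (f : I -> V) (d : I -> int) (l : seq I) (b : V) (c : int) :
  0 <= c -> 0 <= b -> all (fun j => 0 <= f j) l ->
  path (fun x y => y <= x) b (map f l) ->
  (forall k, 0 <= c + \sum_(j <- take k l) d j) ->
  0 <= b *~ c + \sum_(j <- l) f j *~ d j.
Proof.
elim: l b c => [|j l IH] b c c0 b0.
  by move=> _ _ _; rewrite big_nil addr0; have := ler_mulrz leD c0 b0; rewrite mul0rz.
move=> /= /andP[fj0 fl0] /andP[fjb fl] H.
have cd0 : 0 <= c + d j by have := H 1%N; rewrite /= take0 big_cons big_nil addr0.
(* The term [b *~ c] is lowered to [f j *~ c], which merges with [f j *~ d j] into the new carry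
   term. *)
apply: le_trans (IH (f j) (c + d j) cd0 fj0 fl0 fl _) _.
  by move=> k; have := H k.+1; rewrite /= big_cons addrA.
by rewrite big_cons mulrzDr -addrA; apply: (leD); exact: (ler_mulrz leD).
Qed.

Lemma abel_prefix (I : eqType) (V : porderZmodType)
    (leD : forall x y z : V, x <= y -> x + z <= y + z)
    (f : I -> V) (d : I -> int) (l : seq I) :
  (forall j, 0 <= f j) -> sorted (fun x y => y <= x) (map f l) ->
  (forall k, 0 <= \sum_(j <- take k l) d j) ->
  0 <= \sum_(j <- l) f j *~ d j.
Proof.
move=> f0; case: l => [|j l]; first by move=> _ _; rewrite big_nil.
move=> fl dl; have := @abel_carry _ _ leD f d (j :: l) (f j) 0 (lexx _) (f0 j).
rewrite mulr0z add0r; apply; rewrite /= ?lexx ?f0//=.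
- by apply/allP => k _; exact: f0.
- by move=> k; rewrite add0r; exact: dl.
Qed.

Lemma tot_prefix m (l : seq 'I_m) k (x : {ffun 'I_m -> int}) :
  uniq l -> tot x [set j in take k l] = \sum_(j <- take k l) x j.
Proof.
move=> ul; rewrite /tot big_uniq ?take_uniq//.
by apply: eq_bigl => j; rewrite inE.
Qed.

(** Abel summation applied to [y - x]. It turns the prefix tightness of a greedy bundle into
    optimality for linear functions. *)
Lemma prefix_dominated m (V : porderZmodType)
    (leD : forall x y z : V, x <= y -> x + z <= y + z)
    (f : 'I_m -> V) (l : seq 'I_m) (x y : {ffun 'I_m -> int}) :
  uniq l -> (forall j, j \in l) ->
  (forall j, 0 <= f j) -> sorted (fun a b => b <= a) (map f l) ->
  (forall k, tot x [set j in take k l] <= tot y [set j in take k l]) ->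
  \sum_j f j *~ x j <= \sum_j f j *~ y j.
Proof.
move=> ul ml f0 fl xy.
have sl g : \sum_j g j = \sum_(j <- l) g j :> V.
  by rewrite [RHS]big_uniq//; apply: eq_bigl => j; rewrite ml.
have : 0 <= \sum_(j <- l) f j *~ (y j - x j).
  apply: abel_prefix => // k; rewrite sumrB subr_ge0 -!tot_prefix//; exact: xy.
rewrite !sl; under eq_bigr do rewrite mulrzBr.
by rewrite sumrB => /(leD _ _ (\sum_(j <- l) f j *~ x j)); rewrite add0r subrK.
Qed.

(** * Linear maximization over P(rho_check) with values in [Rgamma R] *)

Lemma lerD_Rgamma (R : realType) (x y z : Rgamma R) : x <= y -> x + z <= y + z.
Proof.
move: x y z => [x1 x2] [y1 y2] [z1 z2] xy.
change (is_true ((x1 + z1 < y1 + z1) ||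
  ((x1 + z1 == y1 + z1) && (x2 + z2 <= y2 + z2)))).
by rewrite ltrD2r (inj_eq (addIr _)) lerD2r.
Qed.

Lemma lerD2l_Rgamma (R : realType) (x y z : Rgamma R) : x <= y -> z + x <= z + y.
Proof. by rewrite ![z + _]addrC; exact: lerD_Rgamma. Qed.

Lemma ler_sum_Rgamma (R : realType) (I : finType) (g h : I -> Rgamma R) :
  (forall j, g j <= h j) -> \sum_j g j <= \sum_j h j.
Proof.
move=> gh; elim/big_ind2: _ => // a b c d ab cd.
exact: (le_trans (lerD_Rgamma _ ab) (lerD2l_Rgamma _ cd)).
Qed.

Definition pos_part (V : porderZmodType) (a : V) : V := if 0 <= a then a else 0.

Lemma pos_part_ge0 (V : porderZmodType) (a : V) : 0 <= pos_part a.
Proof. by rewrite /pos_part; case: ifP. Qed.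

Lemma pos_part_mono (R : realType) (a b : Rgamma R) : a <= b -> pos_part a <= pos_part b.
Proof.
rewrite /pos_part => ab; case: ifP => [a0|_]; first by rewrite (le_trans a0 ab).
by case: ifP.
Qed.

Lemma finite_argmax_tot m (B : set {ffun 'I_m -> int}) S :
  finite_set B -> (B !=set0)%classic ->
  exists2 y, B y & forall x, B x -> tot x S <= tot y S.
Proof.
move=> fB B0; have [y By ymin] := finite_argmin (fun x => - tot x S) fB B0.
by exists y => // x /ymin; rewrite lerN2.
Qed.

Lemma min_demand_finite (R : realType) (m n : nat) (s : {ffun 'I_m -> nat})
  (v : 'I_n -> {ffun 'I_m -> int} -> R) (q : 'I_n -> 'I_m -> R -> R) i p :
  finite_set (min_demand s v q i p).
Proof. by apply: sub_finite_set (finite_box s) => x [[]]. Qed.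

(** The polymatroid greedy formula. The maximum is attained by [y] truncated to the goods with
    [f j >= 0], which stays in the polyhedron. For the upper bound, [f] is replaced by its positive
    part; any feasible [x] obeys the rank bounds on the prefixes, where [y] attains them. *)
Lemma maxs_P_rho_check (R : realType) (m n : nat) (s : {ffun 'I_m -> nat})
    (v : 'I_n -> {ffun 'I_m -> int} -> R) (q : 'I_n -> 'I_m -> R -> R) i p
    (f : 'I_m -> Rgamma R) (l : seq 'I_m) y :
  uniq l -> (forall j, j \in l) -> sorted (fun a b => b <= a) (map f l) ->
  min_demand s v q i p y ->
  (forall k x, min_demand s v q i p x ->
    tot x [set j in take k l] <= tot y [set j in take k l]) ->
  maxs [set \sum_j f j *~ (x : {ffun 'I_m -> int}) j
    | x in P_rho_check s v q i p]%classic = \sum_j pos_part (f j) *~ y j.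
Proof.
move=> ul ml fl By ymax.
have leD := @lerD_Rgamma R.
pose y' := [ffun j => if 0 <= f j then y j else 0].
have y0 j : 0 <= y j by have [[/(_ j)/andP[]]] := By.
have y'0 j : 0 <= y' j by rewrite ffunE; case: ifP.
have y'E : \sum_j pos_part (f j) *~ y j = \sum_j f j *~ y' j.
  by apply: eq_bigr => j _; rewrite /pos_part ffunE; case: ifP; rewrite ?mul0rz.
rewrite y'E; have fB := @min_demand_finite _ _ _ s v q i p.
have B0 : (min_demand s v q i p !=set0)%classic by exists y.
have rho x S : min_demand s v q i p x -> tot x S <= rho_check s v q i S p.
  move=> Bx; have [z Bz zmax] := finite_argmax_tot S fB B0.
  by rewrite /rho_check (maxs_image (f := tot^~ S) Bz zmax) zmax.
apply: (maxs_image (f := fun x : {ffun 'I_m -> int} => \sum_j f j *~ x j)).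
  split => // S; apply: le_trans (rho _ S By); apply: tot_le => j.
  by rewrite ffunE; case: ifP.
move=> x [x0 xrho].
rewrite -y'E.
apply: (@le_trans _ _ (\sum_j pos_part (f j) *~ x j)).
  apply: ler_sum_Rgamma => j; apply: ler_mulrz => //.
  by rewrite /pos_part; case: ifP => // /negbT; rewrite -ltNge => /ltW.
apply: (prefix_dominated leD ul ml) => //.
- by move=> j; exact: pos_part_ge0.
- have -> : [seq pos_part (f j) | j <- l] = map (@pos_part _) (map f l).
    by rewrite -map_comp.
  by apply: homo_sorted fl => a b; exact: pos_part_mono.
move=> k; apply: le_trans (xrho _) _.
by rewrite /rho_check (maxs_image (f := tot^~ [set j in take k l]%SET) By (ymax k)).
Qed.

(** * Payments and demand after a small price increase *)

(** To the right of [k] the function stays on one affine piece, whose slope is the right derivative;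
    strict monotonicity makes this slope positive. *)
Lemma payment_right_linear (R : realType) (q : R -> R) (k : R) :
  payment_function q -> 0 <= k ->
  0 < right_derivative q k /\
  exists2 e, 0 < e &
    forall h, 0 <= h < e -> q (k + h) = q k + right_derivative q k * h.
Proof.
move=> [_ _ [b [c [_ lin]]] qmono _] k0.
(* [l] locates the first breakpoint beyond [k]. Because 0 is put in front of [b], the entry [l] of
   [0 :: b] is the left end of the piece containing [k], and the entry [l] of [b] is its right
   end. *)
pose l := find (fun x => k < x) b; pose a := nth 0 (0 :: b) l.
have lb : (l <= size b)%N by exact: find_size.
have ak : a <= k.
  rewrite /a; case E : l => [//|l'] /=; rewrite leNgt.
  by rewrite (@before_find _ 0 (fun x => k < x) b)// -/l E.
have [e e0 qlin] : exists2 e, 0 < e &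
    forall h, 0 <= h < e -> q (k + h) = q k + c l * h.
  (* Beyond the last breakpoint the piece is unbounded and any positive length works, here 1. *)
  exists (if (l < size b)%N then nth 0 b l - k else 1).
    case: ifP => // lsb; rewrite subr_gt0.
    by apply: (@nth_find _ 0 (fun x => k < x)); rewrite has_find.
  move=> h /andP[h0 he].
  have qa x : k <= x -> ((l < size b)%N -> x < nth 0 b l) -> q x = q a + c l * (x - a).
    by move=> kx; apply: lin => //; exact: le_trans kx.
  rewrite (qa k) ?(qa (k + h)) ?lerDl//; first ring.
    by move=> lsb; rewrite lsb ltrBrDl in he.
  move=> lsb; apply: le_lt_trans (_ : k <= k + h) _; first by rewrite lerDl.
  by rewrite lsb ltrBrDl in he.
have near_e : \forall h \near ((0 : R)^'+)%classic, 0 < h < e.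
  near=> h; apply/andP; split; near: h; [exact: nbhs_right_gt|exact: nbhs_right_lt].
have -> : right_derivative q k = c l.
  apply: (lim_near_cst (@norm_hausdorff _ _)).
  near=> h; have /andP[h0 he] : 0 < h < e by near: h.
  rewrite qlin; last by rewrite he ltW.
  by rewrite addrAC subrr add0r mulrCA mulVf ?mulr1// gt_eqF.
split; last by exists e.
have := qmono k (k + e / 2) k0; rewrite ltrDl divr_gt0// => /(_ isT).
rewrite qlin ?ltrDl ?pmulr_lgt0 ?divr_gt0//.
by apply/andP; split; [rewrite divr_ge0// ltW|rewrite gtr_pMr// invf_lt1// ltr1n].
Unshelve. all: by end_near. Qed.

(** Payments are linear in the bundle, so an exchange preserves the sum of the two payments. The
    concavity inequality thus passes to utilities, and two optimal bundles can only be exchanged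
    into optimal ones. *)
Lemma demand_exchange (R : realType) (m n : nat) (s : {ffun 'I_m -> nat})
  (v : 'I_n -> {ffun 'I_m -> int} -> R) (q : 'I_n -> 'I_m -> R -> R) i p :
  Mnat_concave s (v i) -> exchange (demand s v q i p).
Proof.
move=> vex x y [bx xmax] [by_ ymax] j yxj.
have jxy : j \in supp_pos (x - y) by rewrite inE ffun_addE ffun_oppE subr_gt0.
have [k [kxy vle]] := vex x y bx by_ j jxy; exists k.
set x' := x - chi_opt (Some j) + chi_opt k in vle *.
set y' := y + chi_opt (Some j) - chi_opt k in vle *.
(* The left-hand side is finite, whereas [vext] is -oo outside the box. *)
have [bx' by'] : box s x' /\ box s y'.
  move: vle; rewrite /vext (mem_set bx) (mem_set by_).
  by case: ifP => [/set_mem ?|_]; case: ifP => [/set_mem ?|_].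
move: vle; rewrite /vext !mem_set// -!EFinD lee_fin => vle.
have : utility v q i x p + utility v q i y p <= utility v q i x' p + utility v q i y' p.
  rewrite /utility.
  suff : \sum_j0 q i j0 (p j0) * (x j0)%:~R + \sum_j0 q i j0 (p j0) * (y j0)%:~R =
     \sum_j0 q i j0 (p j0) * (x' j0)%:~R + \sum_j0 q i j0 (p j0) * (y' j0)%:~R by lra.
  rewrite -!big_split; apply: eq_bigr => l _ /=.
  rewrite -!mulrDr -!intrD -!ffun_addE; congr (_ * (_ _)%:~R).
  by rewrite /x' /y' addrACA subrr addr0 addrACA addNr addr0.
have ux := xmax _ bx'; have uy := ymax _ by' => uxy.
split => //.
- by case: k kxy {vle x' y' bx' by' ux uy uxy} => // k; rewrite inE ffun_addE ffun_oppE subr_lt0.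
- by split=> // b /xmax ub; lra.
- by split=> // b /ymax ub; lra.
Qed.

Lemma near_finite_set (T : eqType) (I : Type) (F : set_system I) (A : set T)
  (P : T -> I -> Prop) : Filter F -> finite_set A ->
  (forall a, A a -> \forall e \near F, P a e) ->
  \forall e \near F, forall a, A a -> P a e.
Proof.
move=> FF /finite_seqP[l ->]; elim: l => [|a l IH] H.
  by near=> e.
have Ha := H a (mem_head a l).
have {}IH : \forall e \near F, forall b, [set` l]%classic b -> P b e.
  by apply: IH => b bl; apply: H; rewrite /= in_cons [X in _ || X]bl orbT.
near=> e => b /=; rewrite in_cons => /orP[/eqP->|]; first by near: e.
by move: b; near: e.
Unshelve. all: by end_near. Qed.

(** The rate at which the payment for [x] grows as prices leave [p] in direction [d]. *)
Definition cost (R : realType) (m n : nat) (q : 'I_n -> 'I_m -> R -> R)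
    (p d : {ffun 'I_m -> R}) (i : 'I_n) (x : {ffun 'I_m -> int}) : R :=
  \sum_j right_derivative (q i j) (p j) * d j * (x j)%:~R.

Lemma demand_nonempty (R : realType) (m n : nat) (s : {ffun 'I_m -> nat})
    (v : 'I_n -> {ffun 'I_m -> int} -> R) (q : 'I_n -> 'I_m -> R -> R) i p :
  (demand s v q i p !=set0)%classic.
Proof.
have box0 : (box s !=set0)%classic by exists 0 => j; rewrite ffunE lexx.
have [x bx xmax] := finite_argmin (fun x => - utility v q i x p) (finite_box s) box0.
by exists x; split => // y /xmax; rewrite lerN2.
Qed.

(** For small [e] the utility of [x] drops by exactly [e] times its cost, which is at most [e * K],
    where [K] is the cost of the whole supply. The finitely many bundles not demanded at [p] trail
    by more than that, so only ties are affected, and cheapest demanded bundles survive. *)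
Lemma near_demand (R : realType) (m n : nat) (s : {ffun 'I_m -> nat})
    (v : 'I_n -> {ffun 'I_m -> int} -> R) (q : 'I_n -> 'I_m -> R -> R) i
    (p d : {ffun 'I_m -> R}) :
  (forall j, payment_function (q i j)) ->
  (forall j, 0 <= p j) -> (forall j, 0 <= d j) ->
  \forall e \near (0^'+)%classic,
    (forall x, demand s v q i (p + e *: d) x -> demand s v q i p x) /\
    (forall y, demand s v q i p y ->
      (forall x, demand s v q i p x -> cost q p d i y <= cost q p d i x) ->
      demand s v q i (p + e *: d) y).
Proof.
move=> qpay p0 d0.
have qlin j := payment_right_linear (qpay j) (p0 j).
pose U x := utility v q i x p; pose C x := cost q p d i x.
have c0 j : 0 <= right_derivative (q i j) (p j) * d j.
  by rewrite mulr_ge0// ltW//; have [] := qlin j.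
have C0 x : box s x -> 0 <= C x.
  by move=> bx; apply: sumr_ge0 => j _; rewrite mulr_ge0// ler0z; have /andP[] := bx j.
pose K := \sum_j right_derivative (q i j) (p j) * d j * (s j)%:R.
have CK x : box s x -> C x <= K.
  move=> bx; apply: ler_sum => j _; rewrite ler_wpM2l//.
  by have /andP[_] := bx j; rewrite -(ler_int R).
have K0 : 0 <= K by apply: sumr_ge0 => j _; rewrite mulr_ge0.
have [y0 Dy0] := demand_nonempty s v q i p.
have fA : finite_set (box s `&` ~` demand s v q i p)%classic.
  exact: sub_finite_set (@subIsetl _ _ _) (finite_box s).
have near_lin : \forall e \near ((0 : R)^'+)%classic, forall j,
    q i j (p j + e * d j) = q i j (p j) + right_derivative (q i j) (p j) * (e * d j).
  apply: filter_forall => j; have [_ [r r0 lin]] := qlin j.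
  (* The added 1 keeps the denominator positive when [d j] is 0; likewise for [1 + K] below. *)
  have rd0 : 0 < r / (1 + d j) by rewrite divr_gt0// ltr_pwDl.
  near=> e; apply: lin; apply/andP; split.
    by rewrite mulr_ge0//; near: e; exact: nbhs_right_ge.
  apply: (@le_lt_trans _ _ (e * (1 + d j))).
    rewrite ler_wpM2l ?lerDr//; near: e; exact: nbhs_right_ge.
  by rewrite -ltr_pdivlMr ?ltr_pwDl//; near: e; exact: nbhs_right_lt.
have near_gap : \forall e \near ((0 : R)^'+)%classic, forall x,
    (box s `&` ~` demand s v q i p)%classic x -> e * K < U y0 - U x.
  apply: near_finite_set => // x [bx nDx].
  have gap : 0 < U y0 - U x.
    rewrite subr_gt0 ltNge; apply/negP => y0x; apply: nDx; split => // b bb.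
    by apply: le_trans y0x; exact: Dy0.2.
  have gK0 : 0 < (U y0 - U x) / (1 + K) by rewrite divr_gt0// ltr_pwDl.
  near=> e; apply: (@le_lt_trans _ _ (e * (1 + K))).
    rewrite ler_wpM2l ?lerDr//; near: e; exact: nbhs_right_ge.
  by rewrite -ltr_pdivlMr ?ltr_pwDl//; near: e; exact: nbhs_right_lt.
near=> e.
have e0 : 0 < e by near: e; exact: nbhs_right_gt.
have elin j : q i j (p j + e * d j) =
    q i j (p j) + right_derivative (q i j) (p j) * (e * d j).
  by move: j; near: e.
have egap x : box s x -> ~ demand s v q i p x -> e * K < U y0 - U x.
  move=> bx nDx; have : (box s `&` ~` demand s v q i p)%classic x by [].
  by move: x {bx nDx}; near: e.
have uE x : utility v q i x (p + e *: d) = U x - e * C x.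
  rewrite /U /C /utility /cost mulr_sumr -addrA -opprD -big_split /=.
  congr (_ - _); apply: eq_bigr => j _; rewrite ffunE [(e *: d) j]ffunE elin.
  by rewrite mulrDl; congr (_ + _); rewrite mulrCA !mulrA.
have eC0 x : box s x -> 0 <= e * C x by move=> /C0 ?; rewrite mulr_ge0// ltW.
have eCK x : box s x -> e * C x <= e * K by move=> /CK ?; rewrite ler_pM2l.
split=> [x [bx xmax]|y Dy ymin].
  apply: contrapT => nDx; have gap := egap x bx nDx.
  have := xmax _ Dy0.1; rewrite !uE.
  by have := eC0 x bx; have := eCK _ Dy0.1; lra.
split; first exact: Dy.1.
move=> b bb; rewrite !uE.
have Uy : U y = U y0 by apply/le_anti; rewrite (Dy.2 _ Dy0.1) (Dy0.2 _ Dy.1).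
have [Db|nDb] := pselect (demand s v q i p b).
  have : e * C y <= e * C b by rewrite ler_pM2l//; exact: ymin.
  by have := Dy.2 _ bb; rewrite -/(U b) -/(U y); lra.
by have := egap b bb nDb; have := eC0 b bb; have := eCK _ Dy.1; lra.
Unshelve. all: by end_near. Qed.

(** * Greedy bundles of the minimal demand: over-demand, cost and dependence on the ordering *)

Definition greedy_base (R : realType) (m n : nat) (s : {ffun 'I_m -> nat})
    (v : 'I_n -> {ffun 'I_m -> int} -> R) (q : 'I_n -> 'I_m -> R -> R) i p
    (l : seq 'I_m) (y : {ffun 'I_m -> int}) : Prop :=
  min_demand s v q i p y /\
  forall k x, min_demand s v q i p x ->
    tot x [set j in take k l] <= tot y [set j in take k l].

Lemma demand_finite (R : realType) (m n : nat) (s : {ffun 'I_m -> nat})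
  (v : 'I_n -> {ffun 'I_m -> int} -> R) (q : 'I_n -> 'I_m -> R -> R) i p :
  finite_set (demand s v q i p).
Proof. by apply: sub_finite_set (finite_box s) => x []. Qed.

Lemma greedy_base_exists (R : realType) (m n : nat) (s : {ffun 'I_m -> nat})
    (v : 'I_n -> {ffun 'I_m -> int} -> R) (q : 'I_n -> 'I_m -> R -> R) i p l :
  Mnat_concave s (v i) -> (forall j, j \in l) ->
  exists y, greedy_base s v q i p l y.
Proof.
move=> vex ml; have fD := demand_finite s v q i p.
have [x Dx] := demand_nonempty s v q i p.
have [z Bz _] := finite_minimal fD Dx.
have [|y By ymax] := greedy (min_demand_finite s v q i p) _
  (minimals_exchange fD (demand_exchange vex)) ml.
  by exists z.
by exists y.
Qed.

Lemma mu_image (R : realType) (m n : nat) (s : {ffun 'I_m -> nat})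
    (v : 'I_n -> {ffun 'I_m -> int} -> R) (q : 'I_n -> 'I_m -> R -> R) i p S :
  exists2 y, demand s v q i p y &
    mu s v q i S p = tot y S /\ forall x, demand s v q i p x -> tot y S <= tot x S.
Proof.
have [y Dy ymin] := finite_argmin (fun x => tot x S) (demand_finite s v q i p)
  (demand_nonempty s v q i p).
by exists y => //; split => //; exact: (mins_image (f := tot^~ S)).
Qed.

(** All minimal bundles have the same size, so the largest total on the complement means the least
    on [S]; every demanded bundle lies above a minimal one. *)
Lemma mu_setC (R : realType) (m n : nat) (s : {ffun 'I_m -> nat})
    (v : 'I_n -> {ffun 'I_m -> int} -> R) (q : 'I_n -> 'I_m -> R -> R) i p y S :
  Mnat_concave s (v i) -> min_demand s v q i p y ->
  (forall x, min_demand s v q i p x -> tot x (~: S) <= tot y (~: S)) ->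
  mu s v q i S p = tot y S.
Proof.
move=> vex By ymax; apply: (mins_image (f := tot^~ S)); first exact: By.1.
move=> x Dx; have fD := demand_finite s v q i p.
have [z Bz zx] := finite_minimal fD Dx.
apply: le_trans (tot_le S zx); have := ymax z Bz.
have := minimal_min_tot fD (demand_exchange vex) By Bz.1.
by rewrite !(tot_setC _ S); lia.
Qed.

(** On minimal bundles, which share one size, minimizing the cost amounts to maximizing with
    coefficients [C - c j]. The constant [C] only has to dominate every [c j], so that these are
    nonnegative, and they decrease along [l]. Other demanded bundles cost at least as much as a
    minimal one below them. *)
Lemma greedy_base_cost (R : realType) (m n : nat) (s : {ffun 'I_m -> nat})
    (v : 'I_n -> {ffun 'I_m -> int} -> R) (q : 'I_n -> 'I_m -> R -> R) i
    (p d : {ffun 'I_m -> R}) l y :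
  Mnat_concave s (v i) -> uniq l -> (forall j, j \in l) ->
  greedy_base s v q i p l y ->
  (forall j, 0 <= right_derivative (q i j) (p j) * d j) ->
  sorted (fun j k => right_derivative (q i j) (p j) * d j <=
                     right_derivative (q i k) (p k) * d k) l ->
  forall x, demand s v q i p x -> cost q p d i y <= cost q p d i x.
Proof.
move=> vex ul ml [By ymax] c0 cl x Dx.
set c := fun j => right_derivative (q i j) (p j) * d j in c0 cl.
have fD := demand_finite s v q i p.
have [z Bz zx] := finite_minimal fD Dx.
have zxC : cost q p d i z <= cost q p d i x.
  by apply: ler_sum => j _; rewrite ler_wpM2l ?c0// ler_int.
apply: le_trans zxC; pose C := \sum_j c j.
have leD (a b e : R) : a <= b -> a + e <= b + e by rewrite lerD2r.
have cC j : c j <= C by rewrite /C (bigD1 j)//= lerDl; apply: sumr_ge0 => k _; exact: c0.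
have costE (u : {ffun 'I_m -> int}) :
    \sum_j (C - c j) *~ u j = C * (tot u [set: 'I_m])%:~R - cost q p d i u.
  have -> : tot u [set: 'I_m] = \sum_j u j by apply: eq_bigl => j; rewrite inE.
  rewrite rmorph_sum /= mulr_sumr /cost -sumrB; apply: eq_bigr => j _.
  by rewrite -mulrzr mulrBl.
have : \sum_j (C - c j) *~ z j <= \sum_j (C - c j) *~ y j.
  apply: (prefix_dominated leD ul ml); last by move=> k; exact: ymax.
    by move=> j; rewrite subr_ge0.
  rewrite sorted_map; apply: sub_sorted cl => j k /=.
  by rewrite lerD2l lerN2.
have -> : \sum_j (C - c j) *~ z j = C * (tot y [set: 'I_m])%:~R - cost q p d i z.
  rewrite costE; congr (_ * _%:~R - _); apply/le_anti.
  rewrite (minimal_min_tot fD (demand_exchange vex) Bz By.1).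
  by rewrite (minimal_min_tot fD (demand_exchange vex) By Bz.1).
by rewrite costE lerD2l lerN2.
Qed.

(** From length [size o1] on, both orderings have the same prefix sets, and both bundles attain the
    maximal total there. Consecutive prefixes differ by one good of [l], whose coordinate is thereby
    determined. *)
Lemma greedy_base_agree (R : realType) (m n : nat) (s : {ffun 'I_m -> nat})
    (v : 'I_n -> {ffun 'I_m -> int} -> R) (q : 'I_n -> 'I_m -> R -> R) i p
    (o1 o2 l : seq 'I_m) y1 y2 :
  uniq (o1 ++ l) -> perm_eq o1 o2 ->
  greedy_base s v q i p (o1 ++ l) y1 -> greedy_base s v q i p (o2 ++ l) y2 ->
  forall j, j \in l -> y1 j = y2 j.
Proof.
move=> ul o12 [By1 y1max] [By2 y2max] j jl.
have Sk k : [set j in take (size o1 + k) (o1 ++ l)]%SET =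
            [set j in take (size o1 + k) (o2 ++ l)]%SET.
  apply/setP => a; rewrite !inE {2}(perm_size o12) !take_cat !ltnNge !leq_addr /=.
  by rewrite !addKn !mem_cat (perm_mem o12).
have tE k : tot y1 [set j in take (size o1 + k) (o1 ++ l)] =
            tot y2 [set j in take (size o1 + k) (o1 ++ l)].
  by apply/le_anti; rewrite y1max// andbT Sk y2max.
have jo : j \notin o1.
  by move: ul; rewrite cat_uniq => /and3P[_ /hasPn/(_ j jl)].
have jE : index j (o1 ++ l) = (size o1 + index j l)%N.
  by rewrite index_cat (negbTE jo).
have js : (size o1 + index j l < size (o1 ++ l))%N.
  by rewrite size_cat ltn_add2l index_mem.
have takeS (u : {ffun 'I_m -> int}) :
    \sum_(a <- take (size o1 + index j l).+1 (o1 ++ l)) u a =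
    \sum_(a <- take (size o1 + index j l) (o1 ++ l)) u a + u j.
  rewrite (take_nth j js) big_rcons /=; congr (_ + u _).
  by rewrite -jE nth_index// mem_cat jl orbT.
have := tE (index j l).+1; rewrite !tot_prefix// addnS !takeS.
by have := tE (index j l); rewrite !tot_prefix// => ->; exact: addrI.
Qed.

(** * Perturbation of the dual objective *)

Lemma pos_partD (R : realType) (a b : Rgamma R) :
  0 <= b -> pos_part (a + b) <= pos_part a + b.
Proof.
move=> b0; have pb : b <= pos_part a + b.
  by rewrite -{1}[b]add0r; apply: lerD_Rgamma; exact: pos_part_ge0.
rewrite {1}/pos_part; case: ifP => _; last exact: le_trans pb.
apply: lerD_Rgamma; rewrite /pos_part; case: ifP => // /negbT.
by rewrite -ltNge => /ltW.
Qed.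

(** Since [l i] sorts the reduced weights at [z] and at [z'] alike, the same greedy bundle [y i]
    evaluates both objectives. Lowering [z] by [a] raises each positive part by at most [a], while
    the supply term falls by exactly [a] times the supply. *)
Lemma D2_objective_shift (R : realType) (m n : nat) (s : {ffun 'I_m -> nat})
    (v : 'I_n -> {ffun 'I_m -> int} -> R) (q : 'I_n -> 'I_m -> R -> R) p
    (z z' : {ffun 'I_m -> Rgamma R}) (a : 'I_m -> Rgamma R)
    (l : 'I_n -> seq 'I_m) (y : 'I_n -> {ffun 'I_m -> int}) :
  (forall i, uniq (l i)) -> (forall i j, j \in l i) ->
  (forall i, greedy_base s v q i p (l i) (y i)) ->
  (forall i, sorted (fun j k => weight q p i k - z k <= weight q p i j - z j) (l i)) ->
  (forall i, sorted (fun j k => weight q p i k - z' k <= weight q p i j - z' j) (l i)) ->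
  (forall j, 0 <= a j) -> (forall j, z' j = z j - a j) ->
  D2_objective s v q p z' <=
  D2_objective s v q p z + \sum_j a j *~ (\sum_i y i j - (s j)%:Z).
Proof.
move=> ul ml yl lz lz' a0 z'E.
have maxsE (w : {ffun 'I_m -> Rgamma R}) i :
    sorted (fun j k => weight q p i k - w k <= weight q p i j - w j) (l i) ->
    maxs [set \sum_j (weight q p i j - w j) *~ (x : {ffun 'I_m -> int}) j
      | x in P_rho_check s v q i p]%classic =
    \sum_j pos_part (weight q p i j - w j) *~ y i j.
  move=> lw; have [By ymax] := yl i.
  by apply: (maxs_P_rho_check (ul i) (ml i)) By ymax; rewrite sorted_map.
rewrite /D2_objective (eq_bigr _ (fun i _ => maxsE z' i (lz' i))).
rewrite (eq_bigr _ (fun i _ => maxsE z i (lz i))).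
have -> : \sum_j a j *~ (\sum_i y i j - (s j)%:Z) =
    \sum_i \sum_j a j *~ y i j - \sum_j a j *+ s j.
  rewrite exchange_big -sumrB; apply: eq_bigr => j _.
  by rewrite mulrzBr mulrz_sumr.
have -> : \sum_j z' j *+ s j = \sum_j z j *+ s j - \sum_j a j *+ s j.
  by rewrite -sumrB; apply: eq_bigr => j _; rewrite z'E mulrnBl.
rewrite addrACA -big_split /=; apply: lerD_Rgamma.
apply: ler_sum_Rgamma => i; rewrite -big_split /=; apply: ler_sum_Rgamma => j.
rewrite -mulrzDl z'E opprB addrA addrAC.
apply: (ler_mulrz (@lerD_Rgamma R)); last exact: pos_partD.
by have [[[/(_ j)/andP[]]]] := yl i.
Qed.

(** There are finitely many positive differences; a bonus of [e] granted to some coordinates then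
    reverses no strict comparison. *)
Lemma small_tiebreak (R : realType) (I J : finType) (a : I -> J -> R) :
  exists2 e, 0 < e & forall i j k, a i j < a i k -> e < a i k - a i j.
Proof.
suff : \forall e \near ((0 : R)^'+)%classic,
    0 < e /\ forall i j k, a i j < a i k -> e < a i k - a i j.
  by move=> /filter_ex[e [e0 H]]; exists e.
have H : \forall e \near ((0 : R)^'+)%classic,
    forall i j k, a i j < a i k -> e < a i k - a i j.
  do 3 apply: filter_forall => ?.
  case: ltP => [?|_]; last by near=> e.
  by near=> e => _; near: e; apply: nbhs_right_lt; rewrite subr_gt0.
by near=> e; split; near: e => //; exact: nbhs_right_gt.
Unshelve. all: by end_near. Qed.

Lemma lexleE (R : realType) (a1 a2 b1 b2 : R) :
  (((a1, a2) : Rgamma R) <= (b1, b2)) = (a1 < b1) || ((a1 == b1) && (a2 <= b2)).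
Proof. by []. Qed.

Lemma direction_ge0 (R : realType) (m : nat) (X : {set 'I_m})
  (t : {ffun 'I_m -> R}) j : 0 <= direction X t j.
Proof. by rewrite ffunE; case: ifP; rewrite ?expR_ge0. Qed.

(* Perturbing z* to z* - gamma e chi_W strictly increases the dual objective;
   for small e the bundles optimal for the perturbed problem are still optimal
   at z*, so they must over-demand W. *)
Lemma D2_tight_bundles (R : realType) (m n : nat) (s : {ffun 'I_m -> nat})
    (v : 'I_n -> {ffun 'I_m -> int} -> R) (q : 'I_n -> 'I_m -> R -> R)
    (p t : {ffun 'I_m -> R}) (X Y : {set 'I_m}) :
  (forall i, Mnat_concave s (v i)) ->
  (forall i j, 0 < right_derivative (q i j) (p j)) ->
  D2_minimal_solution s v q p (lex_vector X t) ->
  exists y : 'I_n -> {ffun 'I_m -> int},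
  [/\ forall i, demand s v q i p (y i),
      forall i x, demand s v q i p x ->
        cost q p (direction X t) i (y i) <= cost q p (direction X t) i x,
      forall i, mu s v q i X p = tot (y i) X,
      forall i, mu s v q i (X :|: Y) p = tot (y i) (X :|: Y)
    & X :\: Y != finset.set0 ->
      \sum_(j in X :\: Y) (s j)%:Z < \sum_i tot (y i) (X :\: Y)].
Proof.
move=> vex rd0 [[[z0 zmin] zminimal] _]; set W := X :\: Y.
set z := lex_vector X t in z0 zmin zminimal.
(* The infinitesimal part of the reduced weight at [z]. On [X] the cost coefficient of good [j] is
   [expR (- a i j)], so decreasing reduced weight means increasing cost. *)
pose a i j := - ln (right_derivative (q i j) (p j)) - t j.
have [e e0 eP] := small_tiebreak a.
pose w j : R := if j \in W then e else 0.
have tieP i j k : a i k + w k <= a i j + w j -> a i k <= a i j.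
  rewrite !leNgt; apply: contraNN => /eP; rewrite /w.
  by case: ifP => _; case: ifP => _; lra.
pose al j : Rgamma R := (0, w j).
pose z' := [ffun j => z j - al j].
pose f i j := weight q p i j - z j.
pose f' i j := weight q p i j - z' j.
have fE i j : f i j = ((j \notin X)%:R, a i j) :> Rgamma R.
  rewrite /f /z /weight [lex_vector _ _ _]ffunE [chi _ _ _]ffunE.
  by case: (j \in X) => /=; congr (_, _); rewrite ?subrr ?subr0.
have f'E i j : f' i j = ((j \notin X)%:R, a i j + w j) :> Rgamma R.
  rewrite /f' [z' j]ffunE opprB addrA addrAC -/(f i j) fE.
  by congr (_, _); rewrite addr0.
have wX j : j \notin X -> w j = 0 by rewrite /w !inE => /negbTE ->; rewrite andbF.
pose r i : rel 'I_m := fun j k => f' i k <= f' i j.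
have rtot i : total (r i) by move=> j k; exact: le_total.
have rtrans i : transitive (r i) by move=> b c d; rewrite /r => bc cd; exact: le_trans cd bc.
have rf i j k : r i j k -> f i k <= f i j.
  rewrite /r !f'E !fE !lexleE => /orP[->//|/andP[-> /tieP ->]].
  by rewrite orbT.
(* Reduced weights have real part 1 outside [X] and 0 on [X], so [out i ++ lin i] is sorted for the
   dual problem. Costs vanish outside [X], so [o2 ++ lin i] is still sorted by cost; moreover the
   complements of [X :|: Y] and of [X] are among its prefixes. *)
pose lin i := sort (r i) [seq j <- enum 'I_m | j \in X].
pose out i := sort (r i) [seq j <- enum 'I_m | j \notin X].
pose o2 := enum (~: (X :|: Y)) ++ enum (Y :\: X).
have minX i j : (j \in lin i) = (j \in X).
  by rewrite mem_sort mem_filter mem_enum andbT.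
have mout i j : (j \in out i) = (j \notin X).
  by rewrite mem_sort mem_filter mem_enum andbT.
have mo2 j : (j \in o2) = (j \notin X).
  by rewrite mem_cat !mem_enum !inE; case: (j \in X); case: (j \in Y).
have ulin i : uniq (lin i) by rewrite sort_uniq filter_uniq ?enum_uniq.
have uout i : uniq (out i) by rewrite sort_uniq filter_uniq ?enum_uniq.
have uo2 : uniq o2.
  rewrite cat_uniq !enum_uniq andbT /=; apply/hasPn => j.
  by rewrite !mem_enum !inE; case: (j \in Y); rewrite ?orbT ?andbF.
have perm_o i : perm_eq (out i) o2.
  by apply: uniq_perm => // j; rewrite mout mo2.
have ucat o i : uniq o -> (forall j, (j \in o) = (j \notin X)) -> uniq (o ++ lin i).
  move=> uo mo; rewrite cat_uniq uo ulin andbT /=; apply/hasPn => j.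
  by rewrite minX /= mo negbK.
have mcat o i : (forall j, (j \in o) = (j \notin X)) -> forall j, j \in o ++ lin i.
  by move=> mo j; rewrite mem_cat mo minX orNb.
(* [y1] serves to evaluate the dual objective and [y] is the witness; they agree on [X] because the
   orderings share the tail [lin i]. *)
have [y1 y1P] := choice (fun i => greedy_base_exists q p (vex i) (mcat (out i) i (mout i))).
have [y yP] := choice (fun i => greedy_base_exists q p (vex i) (mcat o2 i mo2)).
have By i : min_demand s v q i p (y i) by have [] := yP i.
have yX i j : j \in X -> y1 i j = y i j.
  rewrite -(minX i) => jl.
  exact: greedy_base_agree (ucat _ i (uout i) (mout i)) (perm_o i) (y1P i) (yP i) j jl.
have prefix_mu i S k : [set j in take k (o2 ++ lin i)]%SET = ~: S ->
    mu s v q i S p = tot (y i) S.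
  move=> kS; apply: mu_setC (vex i) (By i) _ => x Bx.
  by rewrite -kS; have [_] := yP i; apply.
exists y; split.
- by move=> i; have [] := By i.
- move=> i; apply: greedy_base_cost (vex i) (ucat _ i uo2 mo2) (mcat _ i mo2) (yP i) _ _.
    by move=> j; rewrite mulr_ge0 ?direction_ge0// ltW.
  pose c j := right_derivative (q i j) (p j) * direction X t j.
  have cX j : j \in X -> c j = expR (- a i j).
    move=> jX; rewrite /c ffunE jX /a opprD !opprK expRD lnK//.
    by rewrite posrE.
  have c0 j : j \notin X -> c j = 0 by rewrite /c ffunE => /negbTE ->; rewrite mulr0.
  have cge0 j : 0 <= c j.
    by case: (boolP (j \in X)) => [/cX ->|/c0 ->//]; exact: expR_ge0.
  have ctrans : transitive (fun j k => c j <= c k) by move=> b d g; exact: le_trans.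
  rewrite (sorted_pairwise ctrans) pairwise_cat; apply/and3P; split.
  + by apply/allrelP => j k; rewrite mo2 => /c0 -> _.
  + have : all (fun j => j \notin X) o2 by apply/allP => j; rewrite mo2.
    elim: {mo2 uo2 perm_o yP By yX prefix_mu} o2 => //= j o IH /andP[jX oX].
    by rewrite IH// andbT; apply/allP => k ko; rewrite (c0 j).
  + rewrite -(sorted_pairwise ctrans).
    (* The order by decreasing [a i j + w j] also has decreasing [a i j] by [tieP], hence increasing
       cost. *)
    have : sorted (r i) (lin i) by exact: sort_sorted.
    apply: (@sub_in_sorted _ (mem X)); last by apply/allP => j; rewrite minX.
    move=> j k jX kX; rewrite /r !f'E !cX// lexleE jX kX ltxx eqxx /= ler_expR lerN2.
    exact: tieP.
- move=> i; apply: (prefix_mu i X (size o2)).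
  by rewrite take_size_cat//; apply/setP => j; rewrite !inE mo2.
- move=> i; apply: (prefix_mu i (X :|: Y) (size (enum (~: (X :|: Y))))).
  by rewrite -catA take_size_cat//; apply/setP => j; rewrite !inE mem_enum !inE.
move=> W0.
(* On [X] the real part is 1, so an infinitesimal decrease keeps the coordinate positive; outside
   [X] nothing changes. *)
have z'0 : vle 0 z'.
  move=> j; rewrite [z' j]ffunE; case: (boolP (j \in X)) => jX; last first.
    have -> : z j - al j = z j :> Rgamma R by rewrite /al wX// subr0.
    exact: z0.
  rewrite /z [lex_vector _ _ _]ffunE [chi _ _ _]ffunE jX ffunE.
  by change (is_true (lexle (0, 0) (1 - 0, t j - w j))); rewrite /lexle /= subr0 ltr01.
have al0 j : 0 <= al j.
  change (is_true (lexle (0, 0) (0, w j))); rewrite /lexle /= eqxx /w.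
  by case: ifP => _; rewrite ?lexx ?orbT// (ltW e0) orbT.
have z'z : vle z' z.
  move=> j; have := lerD2l_Rgamma (z' j) (al0 j).
  by rewrite addr0 [z' j]ffunE subrK.
have zz' : D2_objective s v q p z < D2_objective s v q p z'.
  (* Otherwise [z'] would be an optimal solution below the minimal solution [z], hence equal to it,
     although they differ on [W]. *)
  rewrite ltNge; apply/negP => z'le; have [j jW] := set0Pn _ W0.
  have /ffunP/(_ j) : z' = z.
    by apply: zminimal => //; split => // b /zmin; exact: le_trans.
  rewrite ffunE => /eqP; rewrite -subr_eq0 addrAC subrr sub0r oppr_eq0 /al /w jW.
  by move=> /eqP[] /eqP; rewrite gt_eqF.
have lr i : sorted (r i) (out i ++ lin i).
  rewrite (sorted_pairwise (rtrans i)) pairwise_cat -!(sorted_pairwise (rtrans i)).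
  rewrite !sort_sorted// !andbT; apply/allrelP => j k; rewrite mout minX => jX kX.
  by rewrite /r !f'E lexleE jX kX ltr01.
have shift := D2_objective_shift (fun i => ucat _ i (uout i) (mout i))
  (fun i => mcat _ i (mout i)) y1P (fun i => sub_sorted (@rf i) (lr i)) lr al0
  (fun j => ffunE _ j).
(* The increase of the objective is at most gamma [e] times the excess demand [M] of the bundles on
   [W], so [M <= 0] would contradict [zz']. The bundles [y1] may be replaced by [y] there because
   [W] lies in [X]. *)
rewrite ltNge; apply/negP => over.
pose M := \sum_i tot (y i) W - \sum_(j in W) (s j)%:Z.
pose ge : Rgamma R := (0, e).
have sumE : \sum_j al j *~ (\sum_i y1 i j - (s j)%:Z) = ge *~ M.
  have -> : M = \sum_(j in W) (\sum_i y i j - (s j)%:Z).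
    by rewrite sumrB exchange_big.
  rewrite mulrz_sumr big_mkcond [RHS]big_mkcond /=; apply: eq_bigr => j _.
  rewrite /al /w; case: ifP => jW; last exact: mul0rz.
  congr (_ *~ (_ - _)); apply: eq_bigr => i _; apply: yX.
  by move: jW; rewrite inE => /andP[].
have ge0 : 0 <= ge by rewrite lexleE eqxx ltW// orbT.
have M0 : 0 <= - M by rewrite oppr_ge0 subr_le0.
have := ler_mulrz (@lerD_Rgamma R) M0 ge0; rewrite mul0rz mulrNz.
move=> /(lerD2l_Rgamma (D2_objective s v q p z + ge *~ M)); rewrite addr0 addrK.
by rewrite -sumE => /(le_trans shift); rewrite leNgt zz'.
Qed.

(** * Comparison of over-demands along the direction *)

Theorem theorem4p4 (R : realType) (m n : nat) (hn : (2 <= n)%N)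
    (s : {ffun 'I_m -> nat})
    (v : 'I_n -> {ffun 'I_m -> int} -> R)
    (q : 'I_n -> 'I_m -> R -> R)
    (hM : market s v q)
    (p : {ffun 'I_m -> R}) (hp : forall j, 0 <= p j)
    (X : {set 'I_m}) (hX : minimal_maximizer s v q p X)
    (t : {ffun 'I_m -> R})
    (ht : D2_minimal_solution s v q p (lex_vector X t)) :
  LSC s v q p (direction X t).
Proof.
have [val pay _] := hM.
have vex i : Mnat_concave s (v i) by have [] := val i.
have rd0 i j : 0 < right_derivative (q i j) (p j).
  by have [] := payment_right_linear (pay i j) (hp j).
have d0 := direction_ge0 X t; split => //.
have suppX : supp_pos (direction X t) = X.
  apply/setP => j; rewrite inE ffunE; case: ifP; rewrite ?ltxx// => _.
  exact: expR_gt0.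
have : \forall e \near ((0 : R)^'+)%classic, forall i,
    (forall x, demand s v q i (p + e *: direction X t) x -> demand s v q i p x) /\
    (forall y, demand s v q i p y ->
      (forall x, demand s v q i p x ->
        cost q p (direction X t) i y <= cost q p (direction X t) i x) ->
      demand s v q i (p + e *: direction X t) y).
  by apply: filter_forall => i; exact: near_demand (pay i) hp d0.
case=> delta /= delta0 H; exists delta => // e /andP[e0 edelta].
(* At [e = 0] the prices are [p] and the claim is the hypothesis on [X]; [near_demand] covers
   positive [e] only. *)
rewrite suppX; move: e0; rewrite le_eqVlt => /orP[/eqP <-|e0].
  by rewrite scale0r addr0.
have ball_e : `|0 - e| < delta by rewrite sub0r normrN gtr0_norm.
have Dp' := H e ball_e e0; set p' := p + e *: direction X t in Dp' *.
(* This suffices: [X] is then a maximizer contained in every maximizer. *)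
have over Y : (overdemand s v q p' Y <= overdemand s v q p' X) /\
    (~~ (X \subset Y) -> overdemand s v q p' Y < overdemand s v q p' X).
  have [y [Dy ymin muX muXY tight]] := D2_tight_bundles Y vex rd0 ht.
  (* Being cheapest among the bundles demanded at [p], [y i] is still demanded at [p'], which bounds
     [mu] on [Y] from above. All bundles demanded at [p'] are demanded at [p], so [mu] on [X] cannot
     fall. *)
  have muY i : mu s v q i Y p' <= tot (y i) Y.
    have [x Dx [-> xmin]] := mu_image s v q i p' Y.
    by apply: xmin; exact: (Dp' i).2 _ (Dy i) (ymin i).
  have muX' i : tot (y i) X <= mu s v q i X p'.
    rewrite -muX; have [x Dx [-> _]] := mu_image s v q i p' X.
    have [b Db [-> bmin]] := mu_image s v q i p X.
    by apply: bmin; exact: (Dp' i).1.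
  have XY : overdemand s v q p (X :|: Y) <= overdemand s v q p X.
    by have [[_ +] _] := hX.1; apply.
  move: XY; rewrite /overdemand (eq_bigr _ (fun i _ => muX i)) (eq_bigr _ (fun i _ => muXY i)).
  (* The union of [X] and [Y] splits into [X :\: Y] and [Y], and so does the excess of the bundles
     [y] over the supply. The excess on [X :\: Y], positive unless that set is empty, is the gain of
     [X] over [Y]. *)
  have YE : Y = (X :|: Y) :\: (X :\: Y).
    by apply/setP => j; rewrite !inE; case: (j \in X); case: (j \in Y).
  have sub : X :\: Y \subset X :|: Y.
    by apply/fintype.subsetP => j; rewrite !inE => /andP[_ ->].
  have totE i : tot (y i) (X :|: Y) = tot (y i) (X :\: Y) + tot (y i) Y.
    by rewrite (tot_setD _ sub) -YE.
  have sE : \sum_(j in X :|: Y) (s j)%:Z = \sum_(j in X :\: Y) (s j)%:Z + \sum_(j in Y) (s j)%:Z.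
    pose sZ := [ffun j => (s j)%:Z].
    have sZE (T : {set 'I_m}) : \sum_(j in T) (s j)%:Z = tot sZ T.
      by apply: eq_bigr => j _; rewrite ffunE.
    by rewrite !sZE (tot_setD sZ sub) -YE.
  rewrite (eq_bigr _ (fun i _ => totE i)) big_split /= sE.
  have h1 : \sum_i mu s v q i Y p' <= \sum_i tot (y i) Y by exact: ler_sum.
  have h2 : \sum_i tot (y i) X <= \sum_i mu s v q i X p' by exact: ler_sum.
  have [W0|W0] := eqVneq (X :\: Y) finset.set0.
    rewrite W0 big_set0 [\sum_i tot _ finset.set0]big1; last first.
      by move=> i _; exact: big_set0.
    move=> XY; split; first by lra.
    by rewrite -finset.setD_eq0 W0 eqxx.
  have := tight W0 => h3 XY; split; lra.
split; first split.
- by split => // Y _; exact: (over Y).1.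
- move=> Y [_ Ymax] YX; have : X \subset Y.
    by apply: contraT => /(over Y).2; rewrite ltNge Ymax.
  by move=> XY; apply/eqP; rewrite finset.eqEsubset XY andbT.
- move=> Y [[_ Ymax] Ymin]; have XY : X \subset Y.
    by apply: contraT => /(over Y).2; rewrite ltNge Ymax.
  by rewrite (Ymin X)//; split => // Z _; exact: (over Z).1.
Qed.
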